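(* Let $x^{(n)}$ be a sample drawn from $X^{(n)}\sim\mathcal{N}(\mathbf{0},\sigma^2\mathbf{I}_n)$. A perturbation $\xi\in\mathbb{R}^n$ with $\|\xi\|_\infty\leq\eta$ is added to $x^{(n)}$. When $n$ is sufficiently large, for all $\delta>0$ and all $\epsilon>0$, with probability at least $1-\delta$, the perturbed sample $x^{(n)}+\xi$ belongs to the typical set $A_{B_\infty}^{(n)}(X)$, where $$B_\infty=\frac{\eta^2}{2\sigma^2}+\sqrt{\frac{2}{\pi}}\,\frac{\eta}{\sigma}+\Big(1+\frac{1}{2n\sigma^2}\Big)\epsilon .$$
   Context: $X\sim\mathcal{N}(0,\sigma^2)$ is a real Gaussian random variable with density $f$, and $X^{(n)}=(X_1,\dots,X_n)$ is a sequence of $n$ i.i.d. copies of $X$, so that $X^{(n)}\sim\mathcal{N}(\mathbf{0},\sigma^2\mathbf{I}_n)$, the centered Gaussian distribution on $\mathbb{R}^n$ with covariance $\sigma^2$ times the identity $\mathbf{I}_n$. Throughout, $\log$ denotes $\log_2$. The differential entropy of $X$ is $h(X)=-\int f(x)\log f(x)\,dx$ (integral over the support of $f$), which equals $\log(\sqrt{2\pi e}\,\sigma)$. For a number $B$, the typical set is $$A_B^{(n)}(X)=\Big\{(x_1,\dots,x_n):\Big|-\frac1n\log f(x_1,\dots,x_n)-h(X)\Big|\le B\Big\},$$ where $f(x_1,\dots,x_n)=\prod_{i=1}^n f(x_i)$. The norm is $\|\xi\|_\infty=\max_i|\xi_i|$.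
   Formalization: The typical-set radius is log_2(e) times B_∞ (equivalently, log is taken natural): with log = log_2 and radius B_∞ the claim fails, e.g. for η = 4σ, all ξ_i = η, ε = 0.1, where the deviation tends to about 11.54 while B_∞ tends to about 11.29. *)

(* Defs.v *)
From HB Require Import structures.
From mathcomp Require Export all_boot all_order all_algebra.
From mathcomp Require Export all_classical all_reals all_analysis.
Export Order.TTheory GRing.Theory Num.Theory.
Export numFieldNormedType.Exports.

Set Implicit Arguments.
Unset Strict Implicit.
Unset Printing Implicit Defensive.

Local Open Scope classical_set_scope.
Local Open Scope ring_scope.

Definition log2 (R : realType) (x : R) : R := ln x / ln 2.

Definition diff_entropy (R : realType) (f : R -> R) : R :=
  - Rintegral lebesgue_measure [set x | f x != 0] (fun x => f x * log2 (f x)).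

Definition typical_set (R : realType) (f : R -> R) (n : nat) (B : R) :
    set 'rV[R]_n :=
  [set x | `| - (n%:R^-1 * log2 (\prod_(i < n) f (x 0 i))) - diff_entropy f |
           <= B].

Definition mutually_independent (R : realType) (d : measure_display)
    (T : measurableType d) (P : probability T R) (n : nat)
    (X : 'I_n -> {RV P >-> R}) : Prop :=
  forall (J : {set 'I_n}) (E : 'I_n -> set R), (forall i, measurable (E i)) ->
    fine (P [set w | forall i, i \in J -> E i (X i w)]) =
    \prod_(i in J) fine (P (X i @^-1` E i)).

(* The parameter [s] of [normal_prob m s] is the standard deviation. *)
Definition iid_normal (R : realType) (d : measure_display)
    (T : measurableType d) (P : probability T R) (sigma : R) (n : nat)
    (X : 'I_n -> {RV P >-> R}) : Prop :=
  mutually_independent X /\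
  forall (i : 'I_n) (E : set R), measurable E ->
    distribution P (X i) E = normal_prob 0 sigma E.

Definition sample (R : realType) (d : measure_display)
    (T : measurableType d) (P : probability T R) (n : nat)
    (X : 'I_n -> {RV P >-> R}) (w : T) : 'rV[R]_n :=
  \row_(i < n) X i w.

(* This radius is in nats: it bounds the deviation of -(1/n) ln f.  For
   [typical_set], which is in bits, it must be multiplied by
   [log2 (expR 1)]; without this factor the probability that the perturbed
   sample is typical can tend to 0, e.g. for eta = 4 * sigma, all entries of
   xi equal to eta, and eps = 1/10. *)
Definition B_infty (R : realType) (sigma eta eps : R) (n : nat) : R :=
  eta ^+ 2 / (2 * sigma ^+ 2) + Num.sqrt (2 / pi) * (eta / sigma)
  + (1 + 1 / (2 * n%:R * sigma ^+ 2)) * eps.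

(* Main.v *)
(* For the Gaussian density, - log2 f is affine in x ^+ 2, so x is typical iff
   the empirical second moment of x is close to E[X ^+ 2]; the value of
   E[X ^+ 2] is irrelevant because the same integral defines the entropy.
   Over |xi| <= eta the sum of the (x_i + xi_i) ^+ 2 is largest when it equals
   the sum of the (|x_i| + eta) ^+ 2, and smallest when it equals that of the
   max(0, |x_i| - eta) ^+ 2.  This makes the event measurable (P is
   unspecified on other sets), and bounds the
   deviation by eta ^+ 2 + 2 * eta * mean |x_i| plus the deviation of the
   empirical second moment.  The weak law of large numbers (Chebyshev) for |X|
   and X ^+ 2 concludes, with E|X| = sqrt (2 / pi) * sigma and E[X ^+ 4] < +oo. *)

Require Import Defs.
From mathcomp Require Import all_boot all_order all_algebra.
From mathcomp Require Import all_classical all_reals all_analysis.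
From mathcomp Require Import measurable_realfun.
From mathcomp Require Import ring lra.

Set Implicit Arguments.
Unset Strict Implicit.
Unset Printing Implicit Defensive.

Local Open Scope classical_set_scope.
Local Open Scope ring_scope.

(** * Weak law of large numbers for pairwise independent variables with a common law *)

Section weak_law_of_large_numbers.
Local Open Scope ereal_scope.
Context d d' (T : measurableType d) (T' : measurableType d') (R : realType).
Variables (P : probability T R) (nu : probability T' R).

Lemma integral_law (Z : {RV P >-> T'}) (k : T' -> \bar R) :
    (forall A, measurable A -> distribution P Z A = nu A) ->
    nu.-integrable setT k ->
  P.-integrable setT (k \o Z) /\ \int[P]_w k (Z w) = \int[nu]_x k x.
Proof.
move=> Znu ik; have mk := measurable_int _ ik.
have kZ : P.-integrable setT (k \o Z).
  apply/integrableP; split; first exact: measurableT_comp.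
  move/integrableP : ik => [_]; apply: le_lt_trans.
  rewrite -(ge0_integral_distribution Z (f := abse \o k)); last 2 first.
  - exact: measurableT_comp.
  - by move=> x; exact: abse_ge0.
  by rewrite (eq_measure_integral nu) => // A mA _; exact: Znu.
split => //; rewrite -(integral_distribution mk)//.
by apply: eq_measure_integral => A mA _; exact: Znu.
Qed.

(** Independence makes the joint law of [(Y, Z)] agree with [nu \x nu] on rectangles, hence on all
    measurable sets; Fubini then factors the integral. *)
Lemma integral_prod_indep (Y Z : {RV P >-> T'}) (k : T' -> R) :
    (forall A B, measurable A -> measurable B ->
      P (Y @^-1` A `&` Z @^-1` B) = nu A * nu B) ->
    nu.-integrable setT (EFin \o k) ->
  P.-integrable setT (fun w => (k (Y w) * k (Z w))%:E) /\
  \int[P]_w (k (Y w) * k (Z w))%:E =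
  (\int[nu]_x (k x)%:E) * (\int[nu]_x (k x)%:E).
Proof.
move=> indYZ ik; have /measurable_EFinP mk := measurable_int _ ik.
pose phi w := (Y w, Z w).
have mphi : measurable_fun setT phi by exact: measurable_fun_pair.
pose f (z : T' * T') := (k z.1 * k z.2)%:E.
have mf : measurable_fun setT f.
  by apply/measurable_EFinP/measurable_funM; exact: measurableT_comp.
pose law := pushforward P phi.
have lawE A : measurable A -> (nu \x nu) A = law A.
  by move=> mA; apply: product_measure_unique => // B C mB mC; exact: indYZ.
(* By Tonelli, the integral of [|f|] is the square of the integral of [|k|], which is finite. *)
have ifun : (nu \x nu).-integrable setT f.
  apply/integrable12ltyP => //.
  under eq_integral => x _.
    under eq_integral => y _ do rewrite /f/= normrM EFinM.
    rewrite ge0_integralZl//; last by do 2 apply/measurableT_comp => //.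
    over.
  rewrite ge0_integralZr//; last 2 first.
  - by do 2 apply/measurableT_comp => //.
  - exact: integral_ge0.
  have kfin : \int[nu]_x `|k x|%:E < +oo by case/integrableP : ik.
  by apply: lte_mul_pinfty => //; rewrite ?ge0_fin_numE// integral_ge0.
have fphi : P.-integrable setT (f \o phi).
  apply/integrableP; split; first exact: measurableT_comp.
  move/integrableP : ifun => [_]; apply: le_lt_trans.
  rewrite [leRHS](eq_measure_integral law) => [|A mA _]; last exact: lawE.
  by rewrite ge0_integral_pushforward//; exact: measurableT_comp.
split; first exact: fphi.
transitivity (\int[nu \x nu]_z f z).
  rewrite (eq_measure_integral law) => [|A mA _]; last exact: lawE.
  by rewrite integral_pushforward.
rewrite -integral12_prod_meas1// /fubini_F.
under eq_integral => x _.
  under eq_integral => y _ do rewrite /f/= EFinM.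
  rewrite integralZl//.
  over.
rewrite -(fineK (integrable_fin_num _ ik))//.
by rewrite integralZr// fineK// (integrable_fin_num _ ik).
Qed.

(** Chebyshev's inequality: Markov's inequality is applied to the square of the sum, whose cross
    terms integrate to 0 because [k] is centered. The product form avoids dividing extended
    reals. *)
Lemma weak_law (n : nat) (Z : 'I_n -> {RV P >-> T'}) (k : T' -> R) (t : R) :
    (forall i A, measurable A -> distribution P (Z i) A = nu A) ->
    (forall i j A B, i != j -> measurable A -> measurable B ->
      P (Z i @^-1` A `&` Z j @^-1` B) = nu A * nu B) ->
    nu.-integrable setT (EFin \o k) ->
    nu.-integrable setT (fun x => (k x ^+ 2)%:E) ->
    \int[nu]_x (k x)%:E = 0 -> (0 < t)%R ->
  (t ^+ 2)%:E * P [set w | (t <= `|\sum_(i < n) k (Z i w)|)%R]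
  <= n%:R%:E * \int[nu]_x (k x ^+ 2)%:E.
Proof.
move=> Znu indZ ik ik2 k0 t0; have /measurable_EFinP mk := measurable_int _ ik.
pose S w := (\sum_(i < n) k (Z i w))%R.
have mS : measurable_fun setT S.
  by apply: measurable_sum => i; exact: measurableT_comp.
pose SRV : {RV P >-> R} := mfun_Sub (mem_set mS).
have := @markov _ _ _ P SRV (fun x => x ^+ 2)%R t t0.
have prodZ i j : P.-integrable setT (fun w => (k (Z i w) * k (Z j w))%:E) /\
    \int[P]_w (k (Z i w) * k (Z j w))%:E =
    if i == j then \int[nu]_x (k x ^+ 2)%:E else 0.
  have [<-|ij] := eqVneq i j.
    have [] := integral_law (Znu i) ik2.
    by under [X in _ -> X = _ -> _]eq_integral do rewrite expr2.
  have [ZZ ->] := integral_prod_indep (fun A B mA mB => indZ i j A B ij mA mB) ik.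
  by rewrite k0 mul0e.
have SE w : (S w ^+ 2)%:E =
    \sum_(i < n) \sum_(j < n) (k (Z i w) * k (Z j w))%:E.
  rewrite expr2 mulr_suml -sumEFin; apply: eq_bigr => i _.
  by rewrite mulr_sumr -sumEFin.
suff ES : \int[P]_w (S w ^+ 2)%:E = n%:R%:E * \int[nu]_x (k x ^+ 2)%:E.
  move=> /(_ _ _ _)/le_trans; apply => //.
  - by move=> r _; exact: sqr_ge0.
  - by move=> x y; rewrite !nnegrE => x0 y0; rewrite ler_sqr.
  - rewrite -ES unlock le_eqVlt; apply/orP; left; apply/eqP.
    by apply: eq_integral => w _ /=; rewrite real_normK// num_real.
under eq_integral do rewrite SE.
have iZ i j := (prodZ i j).1.
rewrite integral_sum//; last first.
  by move=> i; apply: integrable_sum => // j _; exact: iZ.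
rewrite (eq_bigr (fun=> \int[nu]_x (k x ^+ 2)%:E)) => [|i _]; last first.
  rewrite integral_sum//.
  (* For a fixed [i], only the diagonal term [j = i] survives. *)
  under eq_bigr do rewrite (prodZ _ _).2 eq_sym.
  by rewrite -big_mkcond/= big_pred1_eq.
by rewrite sumr_const card_ord mule_natl.
Qed.
End weak_law_of_large_numbers.

(** On a probability space the bound [|g| <= 1 + g ^+ 2] suffices. *)
Lemma integrable_of_sqr d (T : measurableType d) (R : realType)
    (nu : probability T R) (g : T -> R) :
    measurable_fun setT g -> nu.-integrable setT (fun x => (g x ^+ 2)%:E) ->
  nu.-integrable setT (EFin \o g).
Proof.
move=> mg ig2.
have i1 : nu.-integrable setT (EFin \o cst 1).
  exact: finite_measure_integrable_cst.
apply: (le_integrable measurableT _ _ (integrableD measurableT i1 ig2)).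
  exact/measurable_EFinP.
move=> x _ /=; rewrite lee_fin.
rewrite (@ger0_norm _ (1 + _)) ?addr_ge0 ?sqr_ge0//.
rewrite ler_norml; apply/andP; split; nra.
Qed.

(** The Chebyshev bound involves only the variance of [g] under [nu], so [N] can be fixed before the
    probability space and the variables are given. *)
Lemma weak_law_uniform d' (T' : measurableType d') (R : realType)
    (nu : probability T' R) (g : T' -> R) (t delta : R) :
    measurable_fun setT g -> nu.-integrable setT (fun x => (g x ^+ 2)%:E) ->
    0 < t -> 0 < delta ->
  exists N : nat, forall n, (N <= n)%N ->
  forall d (T : measurableType d) (P : probability T R)
    (Z : 'I_n -> {RV P >-> T'}),
    (forall i A, measurable A -> distribution P (Z i) A = nu A) ->
    (forall i j A B, i != j -> measurable A -> measurable B ->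
      P (Z i @^-1` A `&` Z j @^-1` B) = (nu A * nu B)%E) ->
  (P [set w | n%:R * t <= `|\sum_(i < n) g (Z i w) - n%:R * \int[nu]_x g x|]%R
    <= delta%:E)%E.
Proof.
move=> mg ig2 t0 delta0; set m := (\int[nu]_x g x)%R.
have ig := integrable_of_sqr mg ig2.
have i1 r : nu.-integrable setT (EFin \o cst r).
  exact: finite_measure_integrable_cst.
pose k x := g x - m.
have ik : nu.-integrable setT (EFin \o k).
  exact: (integrableB measurableT ig (i1 m)).
have ik2 : nu.-integrable setT (fun x => (k x ^+ 2)%:E).
  apply: eq_integrable (integrableD measurableT ig2
    (integrableB measurableT (i1 (m ^+ 2)) (integrableZl measurableT (2 * m) ig))) => //.
  by move=> x _ /=; rewrite -EFinD; congr (_%:E); rewrite /k; ring.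
have k0 : (\int[nu]_x (k x)%:E = 0)%E.
  rewrite /k; under eq_integral do rewrite EFinB.
  rewrite integralB//; last exact: (i1 m).
  rewrite integral_cst//= probability_setT mule1 -(fineK (integrable_fin_num _ ig))//.
  by rewrite subee.
pose v := (\int[nu]_x (k x ^+ 2))%R.
have vE : (\int[nu]_x (k x ^+ 2)%:E)%E = v%:E.
  by rewrite /v /Rintegral fineK//; exact: (integrable_fin_num _ ik2).
have v0 : 0 <= v by apply: Rintegral_ge0 => x _; exact: sqr_ge0.
(* Chebyshev bounds the probability by [n * v / (n * t) ^+ 2 = v / (n * t ^+ 2)], which is at most
   [delta] beyond this threshold. *)
have [N Nlt] : exists N : nat, v / (delta * t ^+ 2) < N%:R.
  by exists (Num.truncn (v / (delta * t ^+ 2))).+1; exact: truncnS_gt.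
exists N.+1 => n Nn d T P Z Znu indZ.
have n0 : 0 < n%:R :> R by rewrite ltr0n (leq_trans _ Nn).
have nt0 : 0 < n%:R * t by exact: mulr_gt0.
have := weak_law Znu indZ ik ik2 k0 nt0.
rewrite vE -EFinM.
under [X in (_ * P X <= _)%E -> _]eq_set => w.
  rewrite sumrB sumr_const card_ord -[m *+ n]mulr_natl.
  over.
move=> H.
rewrite -(@lee_pmul2l _ (((n%:R * t) ^+ 2)%:E)) ?lte_fin ?exprn_gt0//.
apply: (le_trans H); rewrite lee_fin.
have nN : v / (delta * t ^+ 2) <= n%:R.
  by rewrite (le_trans (ltW Nlt))// ler_nat ltnW.
rewrite ler_pdivrMr ?mulr_gt0 ?exprn_gt0// in nN.
rewrite exprMn expr2 -!mulrA ler_pM2l//.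
by rewrite (le_trans nN)// le_eqVlt; apply/orP; left; apply/eqP; ring.
Qed.

(** * Moments of the centered normal law *)

Section normal_moments.
Context (R : realType) (sigma : R).
Hypothesis sigma_gt0 : 0 < sigma.
Let mu := @lebesgue_measure R.
Let sigma_neq0 : sigma != 0. Proof. exact: lt0r_neq0. Qed.

Lemma normal_pdf0E x :
  normal_pdf 0 sigma x = normal_peak sigma * expR (- (x ^+ 2 / (2 * sigma ^+ 2))).
Proof.
rewrite normal_pdfE// /normal_fun subr0 mulNr; congr (_ * expR (- (_ / _))).
by rewrite mulr_natl.
Qed.

(** The Radon-Nikodym derivative and [normal_pdf] have the same integral over every measurable set,
    so they agree almost everywhere. *)
Lemma ge0_integral_normal_prob (f : R -> \bar R) : measurable_fun setT f ->
    (forall x, 0 <= f x)%E ->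
  (\int[normal_prob 0 sigma]_x f x = \int[mu]_x (f x * (normal_pdf 0 sigma x)%:E))%E.
Proof.
move=> mf f0; have dom := @normal_prob_dominates R 0 sigma.
rewrite -(Radon_Nikodym_SigmaFinite.change_of_variables dom f0 measurableT mf).
have mpdf : measurable_fun setT (fun x => (normal_pdf 0 sigma x)%:E).
  by apply/measurable_EFinP; exact: measurable_normal_pdf.
have idom := Radon_Nikodym_SigmaFinite.f_integrable dom.
apply: ae_eq_integral => //.
- by apply: emeasurable_funM => //; exact: measurable_int idom.
- exact: emeasurable_funM.
- apply: ae_eqe_mul2l; apply: integral_ae_eq => //= E _ mE.
  by rewrite -Radon_Nikodym_SigmaFinite.f_integral.
Qed.

(** Half of the Gaussian exponent absorbs [x ^+ 4]; the other half is, up to a constant, the density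
    of variance [2 * sigma ^+ 2]. This dominating function gives a finite fourth moment. *)
Lemma pow4_normal_pdf0_le :
  exists2 C, 0 <= C & forall x, x ^+ 4 * normal_pdf 0 sigma x <=
                   C * normal_pdf 0 (Num.sqrt 2 * sigma) x.
Proof.
set s := Num.sqrt 2 * sigma.
have s2E : s ^+ 2 = 2 * sigma ^+ 2 by rewrite exprMn sqr_sqrtr.
have s0 : s != 0 by rewrite lt0r_neq0// mulr_gt0// sqrtr_gt0.
have ps0 : 0 < normal_peak s by exact: normal_peak_gt0.
have p0 : 0 < normal_peak sigma by exact: normal_peak_gt0.
(* With [u = x ^+ 2 / (4 * sigma ^+ 2)] one has [x ^+ 4 = 64 * sigma ^+ 4 * (u / 2) ^+ 2]; the ratio
   of peaks changes one density's normalization into the other's. *)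
exists (64 * sigma ^+ 4 * normal_peak sigma / normal_peak s).
  by rewrite ltW// divr_gt0// mulr_gt0// mulr_gt0// exprn_gt0.
move=> x; rewrite normal_pdf0E normal_pdfE// /normal_fun subr0 mulNr.
rewrite -[s ^+ 2 *+ 2]mulr_natl s2E.
set u := x ^+ 2 / (2 * (2 * sigma ^+ 2)).
have -> : x ^+ 2 / (2 * sigma ^+ 2) = u + u by rewrite /u; field.
have uE : x ^+ 4 = 64 * sigma ^+ 4 * (u / 2) ^+ 2 by rewrite /u; field.
have u0 : 0 <= u by rewrite /u divr_ge0 ?sqr_ge0// mulr_ge0// mulr_ge0// sqr_ge0.
have -> : 64 * sigma ^+ 4 * normal_peak sigma / normal_peak s *
    (normal_peak s * expR (- u)) =
    64 * sigma ^+ 4 * (normal_peak sigma * expR (- u)).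
  by field; rewrite lt0r_neq0.
have eu : (u / 2) ^+ 2 * expR (- u) <= 1.
  rewrite expRN ler_pdivrMr ?expR_gt0// mul1r.
  (* Since [expR u] is the square of [expR (u / 2)], the bound [1 + u / 2 <= expR (u / 2)] is
     enough. *)
  rewrite [in leRHS](_ : u = u / 2 + u / 2); last by field.
  rewrite expRD -expr2 ler_sqr ?nnegrE ?expR_ge0//; last lra.
  have := expR_ge1Dx (u / 2); set E := expR _ => h.
  lra.
rewrite uE opprD expRD -[leLHS]mulrA.
apply: ler_wpM2l; first by rewrite mulr_ge0// exprn_ge0// ltW.
by rewrite mulrCA ler_pM2l// mulrA ler_piMl// expR_ge0.
Qed.

Lemma normal_fourth_moment_fin :
  (normal_prob 0 sigma).-integrable setT (fun x => (x ^+ 4)%:E).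
Proof.
apply/integrableP; split; first by apply/measurable_EFinP; exact: measurable_funX.
rewrite ge0_integral_normal_prob//; last first.
  by apply/measurable_EFinP/measurableT_comp => //; exact: measurable_funX.
have [C C0 xC] := pow4_normal_pdf0_le.
apply: (@le_lt_trans _ _
    (\int[mu]_x (C%:E * (normal_pdf 0 (Num.sqrt 2 * sigma) x)%:E))%E).
  apply: ge0_le_integral => //.
  - by move=> x _; rewrite mule_ge0// lee_fin normal_pdf_ge0.
  - apply: emeasurable_funM; apply/measurable_EFinP.
      by apply/measurableT_comp => //; exact: measurable_funX.
    exact: measurable_normal_pdf.
  - apply: emeasurable_funM => //; apply/measurable_EFinP.
    exact: measurable_normal_pdf.
  - move=> x _; rewrite -!EFinM lee_fin ger0_norm ?xC//.
    exact: (@exprn_even_ge0 _ 4 x).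
rewrite integralZl//; last exact: integrable_normal_pdf.
by rewrite integral_normal_pdf mule1 ltry.
Qed.

(** Supplies the antiderivative used to compute the first absolute moment. *)
Lemma is_derive_normal_pdf0 (x : R) :
  is_derive x (1 : R) (fun y : R => - sigma ^+ 2 * normal_pdf 0 sigma y)
    (x * normal_pdf 0 sigma x).
Proof.
have -> : (fun y => - sigma ^+ 2 * normal_pdf 0 sigma y) =
    (fun y => - sigma ^+ 2 * normal_peak sigma *
              expR ((- (2 * sigma ^+ 2)^-1) * y ^+ 2)).
  apply/funext => y; rewrite normal_pdf0E mulrA; congr (_ * expR _).
  by rewrite mulNr mulrC.
rewrite normal_pdf0E.
have -> : x ^+ 2 / (2 * sigma ^+ 2) = (2 * sigma ^+ 2)^-1 * x ^+ 2 by rewrite mulrC.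
have dE : is_derive x 1 (expR \o (fun y => - (2 * sigma ^+ 2)^-1 * y ^+ 2))
   (- (2 * sigma ^+ 2)^-1 * (2 * x) * expR (- (2 * sigma ^+ 2)^-1 * x ^+ 2)).
  by apply: is_derive_eq; rewrite /GRing.scale/=; ring.
have dF := is_deriveZ (- sigma ^+ 2 * normal_peak sigma) dE.
by apply: (is_derive_eq dF); rewrite /GRing.scale/= [_ * x ^+ 2]mulNr; field.
Qed.

Lemma cvg_normal_pdf0 : normal_pdf 0 sigma x @[x --> +oo] --> 0.
Proof.
have -> : normal_pdf 0 sigma = fun x => normal_peak sigma *
  expR (- (x ^+ 2 * (2 * sigma ^+ 2)^-1)).
  by apply/funext => x; rewrite normal_pdf0E.
rewrite -(mulr0 (normal_peak sigma)); apply: cvgMr.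
apply: (cvg_comp (fun x => x ^+ 2 * (2 * sigma ^+ 2)^-1) (fun x => expR (- x)));
  last exact: cvgr_expR.
by apply: gt0_cvgMly; [rewrite invr_gt0 mulr_gt0// exprn_gt0|exact: cvgr_expr2].
Qed.

Lemma normal_peakE :
  2 * (sigma ^+ 2 * normal_peak sigma) = Num.sqrt (2 / pi) * sigma.
Proof.
rewrite /normal_peak; move: (pi : R) (pi_gt0 R) => p p_gt0.
set a := Num.sqrt (2 / p).
have p0 : p != 0 by exact: lt0r_neq0.
have a2 : a ^+ 2 = 2 / p by rewrite sqr_sqrtr// divr_ge0// ltW.
have a0 : 0 < a by rewrite sqrtr_gt0 divr_gt0.
(* As [a ^+ 2 = 2 / p], the radicand in [normal_peak] becomes a perfect square and the root
   disappears. *)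
have -> : sigma ^+ 2 * p *+ 2 = (a * p * sigma) ^+ 2.
  by rewrite !exprMn a2 -[LHS]mulr_natl; field.
rewrite sqrtr_sqr gtr0_norm; last by rewrite mulr_gt0// mulr_gt0.
have -> : 2 = a ^+ 2 * p by rewrite a2 divfK.
have a_neq0 : a != 0 by exact: lt0r_neq0.
by field; rewrite a_neq0 p0 sigma_neq0.
Qed.

(** By symmetry the integral is twice that over the half-line, where the fundamental theorem of
    calculus leaves only the boundary value at 0, namely [sigma ^+ 2 * normal_peak sigma]. *)
Lemma normal_abs_moment :
  (\int[normal_prob 0 sigma]_x `|x|)%R = Num.sqrt (2 / pi) * sigma.
Proof.
have cpdf := @continuous_normal_pdf R 0 sigma sigma_neq0.
rewrite /Rintegral ge0_integral_normal_prob//; last first.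
  by apply/measurable_EFinP; exact: (@normr_measurable R setT).
under eq_integral do rewrite -EFinM.
rewrite (ge0_symfun_integralT (f := fun x => `|x| * normal_pdf 0 sigma x)).
- rewrite -set_itvcy.
  under eq_integral => x /[!inE]/= /[!in_itv]/= /andP[x0 _]
    do rewrite ger0_norm//.
  rewrite (@ge0_continuous_FTC2y _ _
    (fun y : R => - sigma ^+ 2 * normal_pdf 0 sigma y) _ 0).
  + rewrite /= normal_pdf0E expr0n/= mul0r oppr0 expR0.
    by rewrite mulr1 add0r mulNr opprK normal_peakE.
  + by move=> x x0; rewrite mulr_ge0// normal_pdf_ge0.
  + apply: continuous_subspaceT => x.
    by apply: cvgM; [exact: cvg_id|exact: cpdf].
  + by rewrite -[X in _ --> X](mulr0 (- sigma ^+ 2)); apply: cvgMr; exact: cvg_normal_pdf0.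
  + by move=> x _; have [] := is_derive_normal_pdf0 x.
  + by apply: cvgMr; apply/cvg_at_right_filter; exact: cpdf.
  + by move=> x _; rewrite derive1E; have [_ ->] := is_derive_normal_pdf0 x.
- by move=> x; rewrite mulr_ge0// normal_pdf_ge0.
- move=> x; apply: cvgM; last exact: cpdf.
  exact: norm_continuous.
- by move=> x /=; rewrite normrN !normal_pdf0E sqrrN.
Qed.
End normal_moments.

(** * Entropy and typical set of the normal law *)

Section gaussian_typical_set.
Context (R : realType) (sigma : R).
Hypothesis sigma_gt0 : 0 < sigma.
Let sigma_neq0 : sigma != 0. Proof. exact: lt0r_neq0. Qed.
Let f := normal_pdf 0 sigma.

Definition normal_second_moment := (\int[normal_prob 0 sigma]_x (x ^+ 2))%R.
Local Notation m2 := normal_second_moment.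

Lemma ln_normal_pdf0 x : ln (f x) = ln (normal_peak sigma) - x ^+ 2 / (2 * sigma ^+ 2).
Proof.
have p0 : 0 < normal_peak sigma by exact: normal_peak_gt0.
by rewrite /f normal_pdf0E// lnM ?posrE ?expR_gt0// expRK.
Qed.

Lemma normal_pdf0_gt0 x : 0 < f x.
Proof. by rewrite /f normal_pdf0E// mulr_gt0 ?expR_gt0// normal_peak_gt0. Qed.

Lemma integrable_normal_sqr :
  (normal_prob 0 sigma).-integrable setT (fun x => (x ^+ 2)%:E).
Proof.
apply: (@integrable_of_sqr _ _ _ (normal_prob 0 sigma) (fun x => x ^+ 2)).
  exact: measurable_funX.
apply: eq_integrable (normal_fourth_moment_fin sigma_gt0) => // x _.
by rewrite -exprM.
Qed.

Lemma diff_entropy_normal : diff_entropy f =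
  (normal_second_moment / (2 * sigma ^+ 2) - ln (normal_peak sigma)) / ln 2.
Proof.
have fT : [set x | f x != 0] = setT.
  by apply/seteqP; split => // x _ /=; rewrite lt0r_neq0// normal_pdf0_gt0.
have m2E : (\int[lebesgue_measure]_x (x ^+ 2 * f x) = m2)%R.
  rewrite /m2 /Rintegral ge0_integral_normal_prob//.
  - by apply/measurable_EFinP; exact: measurable_funX.
  - by move=> x; rewrite lee_fin sqr_ge0.
have if0 : lebesgue_measure.-integrable setT (EFin \o f).
  exact: integrable_normal_pdf.
(* Integrability of the square under the normal law is carried over to Lebesgue measure with density
   [f]. *)
have if2 : lebesgue_measure.-integrable setT (EFin \o (fun x => x ^+ 2 * f x)).
  apply/integrableP; split.
    apply/measurable_EFinP; apply: measurable_funM; last exact: measurable_normal_pdf.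
    exact: measurable_funX.
  have /integrableP[_] := integrable_normal_sqr.
  rewrite ge0_integral_normal_prob//; last first.
    by do 2 apply: measurableT_comp => //; exact: measurable_funX.
  congr (_ < _)%E; apply: eq_integral => x _ /=.
  by rewrite -EFinM [`|_ * f x|]normrM (ger0_norm (ltW (normal_pdf0_gt0 x))).
rewrite /diff_entropy fT /log2.
rewrite (_ : (fun x => _) = fun x => (ln (normal_peak sigma) / ln 2) * f x -
    ((2 * sigma ^+ 2)^-1 / ln 2) * (x ^+ 2 * f x)); last first.
  apply/funext => x; rewrite ln_normal_pdf0.
  by move: (ln (normal_peak _)) ((ln 2)^-1) ((2 * _)^-1) => p l s; ring.
rewrite RintegralB//; last 2 first.
- exact: (integrableZl measurableT (ln (normal_peak sigma) / ln 2) if0).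
- exact: (integrableZl measurableT ((2 * sigma ^+ 2)^-1 / ln 2) if2).
rewrite RintegralZl// RintegralZl// m2E.
have -> : (\int[lebesgue_measure]_x f x = 1)%R.
  by rewrite /Rintegral integral_normal_pdf.
by move: (ln (normal_peak _)) ((ln 2)^-1) ((2 * _)^-1) => p l s; ring.
Qed.

(** The terms [ln (normal_peak sigma)] of the empirical and the true entropy cancel, and
    [log2 (expR 1) = 1 / ln 2] cancels the change of base. *)
Lemma typical_set_normalE n (B : R) (x : 'rV[R]_n) : (0 < n)%N ->
  typical_set f (log2 (expR 1) * B) x <->
  `|n%:R^-1 * (\sum_(i < n) x 0 i ^+ 2) - m2| <= 2 * sigma ^+ 2 * B.
Proof.
move=> n0; rewrite /typical_set/= diff_entropy_normal.
have p0 : 0 < normal_peak sigma by exact: normal_peak_gt0.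
have n_neq0 : n%:R != 0 :> R by rewrite pnatr_eq0 -lt0n.
have ln2_gt0 : 0 < ln 2 :> R by rewrite ln_gt0// ltr1n.
have -> : log2 (\prod_(i < n) f (x 0 i)) =
    (n%:R * ln (normal_peak sigma) -
     (\sum_(i < n) x 0 i ^+ 2) / (2 * sigma ^+ 2)) / ln 2.
  rewrite /log2; congr (_ / _).
  rewrite (eq_bigr (fun i => expR (ln (f (x 0 i))))); last first.
    by move=> i _; rewrite lnK// posrE normal_pdf0_gt0.
  rewrite -expR_sum expRK; under eq_bigr do rewrite ln_normal_pdf0.
  by rewrite sumrB sumr_const card_ord -[_ *+ n]mulr_natl -mulr_suml.
rewrite /log2 expRK.
set S := \sum_(i < n) _; set p := ln (normal_peak sigma).
have -> : - (n%:R^-1 * ((n%:R * p - S / (2 * sigma ^+ 2)) / ln 2)) -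
    (m2 / (2 * sigma ^+ 2) - p) / ln 2 =
    (n%:R^-1 * S - m2) * (2 * sigma ^+ 2 * ln 2)^-1.
  by move: (ln 2) ln2_gt0 => l /lt0r_neq0 l0; field; rewrite l0 n_neq0 sigma_neq0.
have c0 : 0 < 2 * sigma ^+ 2 * ln 2.
  by rewrite mulr_gt0// mulr_gt0// exprn_gt0.
rewrite normrM (gtr0_norm (_ : 0 < _^-1)) ?invr_gt0// ler_pdivrMr//.
rewrite (_ : 1 / ln 2 * B * _ = 2 * sigma ^+ 2 * B)//.
by move: (ln 2) ln2_gt0 => l /lt0r_neq0 l0; field.
Qed.
End gaussian_typical_set.

(** * Extremal perturbations in the sup norm *)

Lemma ler_norm_rV (R : realType) n (eta : R) (x : 'rV[R]_n) : 0 <= eta ->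
  `|x| <= eta <-> forall i, `|x 0 i| <= eta.
Proof.
(* The norm unfolds to a maximum with default value 0, which [eta0] bounds. *)
move=> eta0; rewrite {1}/Num.norm/= mx_normrE; split.
  by move=> /bigmax_leP[_ h] i; exact: (h (0, i)).
by move=> h; apply/bigmax_leP; split => // -[i j] _ /=; rewrite (ord1 i).
Qed.

(** Both extremes of the sum of squares are attained, coordinate by coordinate. An uncountable
    family of conditions thus becomes two inequalities in [x]. *)
Lemma sum_sqr_perturb (R : realType) n (eta m b : R) (x : 'I_n -> R) :
    0 <= eta ->
  (forall xi : 'rV[R]_n, `|xi| <= eta ->
    `|n%:R^-1 * (\sum_(i < n) (\row_j x j + xi) 0 i ^+ 2) - m| <= b) <->
  n%:R^-1 * (\sum_(i < n) (`|x i| + eta) ^+ 2) - m <= b /\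
  m - n%:R^-1 * (\sum_(i < n) Num.max 0 (`|x i| - eta) ^+ 2) <= b.
Proof.
move=> eta0; split => [H|[Hup Hlo] xi /(ler_norm_rV _ eta0) xieta].
  split.
    (* This perturbation pushes every coordinate away from 0 by [eta]. *)
    have xieta : `|\row_i (if 0 <= x i then eta else - eta)| <= eta.
      by apply/ler_norm_rV => // i; rewrite mxE; case: ifP; rewrite ?normrN ger0_norm.
    apply: le_trans (ler_norm _) _; apply: le_trans (H _ xieta).
    rewrite le_eqVlt; apply/orP; left; apply/eqP; congr (`|_ * _ - _|).
    apply: eq_bigr => i _; rewrite !mxE; case: (lerP 0 (x i)) => xi0.
      by rewrite ger0_norm.
    by rewrite ltr0_norm//; ring.
  (* This one pulls every coordinate towards 0, cancelling those of absolute value at most [eta]. *)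
  have xieta : `|\row_i (if `|x i| <= eta then - x i
                         else if 0 <= x i then - eta else eta)| <= eta.
    apply/ler_norm_rV => // i; rewrite mxE.
    by case: ifP => [|_]; [|case: ifP]; rewrite ?normrN// ger0_norm.
  have := H _ xieta; rewrite ler_norml => /andP[+ _].
  rewrite -[in X in X -> _]opprB lerN2 => /(le_trans _); apply.
  rewrite lerD2l lerN2 le_eqVlt; apply/orP; left; apply/eqP; congr (_ * _).
  apply: eq_bigr => i _; rewrite !mxE; case: (lerP `|x i| eta) => xe.
    by rewrite subrr (max_idPl _)// subr_le0.
  rewrite (max_idPr _); last by rewrite subr_ge0 ltW.
  case: (lerP 0 (x i)) => xi0.
    by rewrite ger0_norm.
  by rewrite ltr0_norm//; ring.
have n0 : 0 <= n%:R^-1 :> R by rewrite invr_ge0.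
rewrite ler_norml; apply/andP; split.
  rewrite -[leRHS]opprB lerN2; apply: le_trans Hlo.
  rewrite lerD2l lerN2; apply: ler_wpM2l => //; apply: ler_sum => i _.
  rewrite -[leRHS]real_normK ?num_real// ler_sqr ?nnegrE//; last first.
    by rewrite le_max lexx.
  rewrite ge_max normr_ge0 !mxE/= lerBlDr.
  have := ler_normB (x i + xi 0 i) (xi 0 i); rewrite addrK => /le_trans; apply.
  by rewrite lerD2l.
apply: le_trans Hup; rewrite lerD2r; apply: ler_wpM2l => //.
apply: ler_sum => i _; rewrite -[leLHS]real_normK ?num_real// !mxE.
rewrite ler_sqr ?nnegrE ?addr_ge0//.
by apply: le_trans (ler_normD _ _) _; rewrite lerD2l.
Qed.

Lemma sum_sqr_perturb_bounds (R : realType) n (eta m1 m2 t1 t2 : R)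
    (x : 'I_n -> R) : (0 < n)%N -> 0 <= eta ->
    `|\sum_(i < n) `|x i| - n%:R * m1| < n%:R * t1 ->
    `|\sum_(i < n) x i ^+ 2 - n%:R * m2| < n%:R * t2 ->
  n%:R^-1 * (\sum_(i < n) (`|x i| + eta) ^+ 2) - m2 <=
    eta ^+ 2 + 2 * eta * (m1 + t1) + t2 /\
  m2 - n%:R^-1 * (\sum_(i < n) Num.max 0 (`|x i| - eta) ^+ 2) <=
    eta ^+ 2 + 2 * eta * (m1 + t1) + t2.
Proof.
move=> n0 eta0; set S1 := \sum_i `|_|; set S2 := \sum_i _ ^+ 2.
have nR0 : 0 < n%:R :> R by rewrite ltr0n.
rewrite !ltr_norml => /andP[_ S1lt] /andP[S2gt S2lt].
have {}S1lt : eta * S1 <= n%:R * (eta * (m1 + t1)) by nra.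
split; rewrite -(ler_pM2l nR0) mulrBr mulVKf ?lt0r_neq0//.
  have -> : \sum_(i < n) (`|x i| + eta) ^+ 2 =
      S2 + 2 * (eta * S1) + n%:R * eta ^+ 2.
    have -> : n%:R * eta ^+ 2 = \sum_(i < n) eta ^+ 2.
      by rewrite sumr_const card_ord mulr_natl.
    rewrite mulr_sumr mulr_sumr -!big_split/=.
    apply: eq_bigr => i _; rewrite -[x i ^+ 2]real_normK ?num_real//.
    ring.
  lra.
(* Termwise with [y = |x i|]: above [eta], the square is [y ^+ 2 - 2 * eta * y + eta ^+ 2];
   otherwise the right side is 0 and [y ^+ 2 <= 2 * eta * y]. *)
have : S2 - 2 * (eta * S1) <=
    \sum_(i < n) Num.max 0 (`|x i| - eta) ^+ 2.
  rewrite mulr_sumr mulr_sumr -sumrB; apply: ler_sum => i _.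
  rewrite -[x i ^+ 2]real_normK ?num_real//.
  have := normr_ge0 (x i); move: `|x i| => y y0.
  case: (lerP (y - eta) 0) => h; nra.
have : 0 <= n%:R * eta ^+ 2 by rewrite mulr_ge0 ?sqr_ge0// ltW.
lra.
Qed.

(** * From mutual independence to the weak law for normal samples *)

Lemma mutually_independent_pair (R : realType) d (T : measurableType d)
    (P : probability T R) n (X : 'I_n -> {RV P >-> R}) (i j : 'I_n)
    (A B : set R) : mutually_independent X -> i != j ->
    measurable A -> measurable B ->
  P (X i @^-1` A `&` X j @^-1` B) = (P (X i @^-1` A) * P (X j @^-1` B))%E.
Proof.
move=> indX ij mA mB.
pose E (l : 'I_n) := if l == i then A else B.
have mE l : measurable (E l) by rewrite /E; case: ifP.
have mX l C : measurable C -> measurable (X l @^-1` C).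
  by move=> mC; rewrite -[_ @^-1` _]setTI; exact: measurable_funPT.
have := indX [set i; j]%SET E mE.
rewrite big_setU1 ?inE//= big_set1 /E eqxx eq_sym (negbTE ij).
rewrite (_ : [set w | _] = X i @^-1` A `&` X j @^-1` B); last first.
  apply/seteqP; split => w /=.
    move=> H; split; first by have := H i; rewrite !inE eqxx; apply.
    by have := H j; rewrite !inE eqxx orbT eq_sym (negbTE ij); apply.
  by move=> [Ai Bj] l; rewrite !inE => /orP[] /eqP ->;
    rewrite ?eqxx// eq_sym (negbTE ij).
(* Independence is stated between real numbers through [fine]; finiteness of [P] lifts it back to
   extended reals. *)
move=> PE; rewrite -[LHS]fineK ?fin_num_measure//; last first.
  by apply: measurableI; exact: mX.
by rewrite PE EFinM !fineK// fin_num_measure//; exact: mX.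
Qed.

(* [normal_prob] lives on [measurableTypeR R] and the variables take values in
   [R]: the two measurable types have the same measurable sets but different
   displays, hence the detour through [Z]. *)
Lemma weak_law_normal (R : realType) (sigma : R) (g : R -> R) (t delta : R) :
    measurable_fun setT g ->
    (normal_prob 0 sigma).-integrable setT (fun x => (g x ^+ 2)%:E) ->
    0 < t -> 0 < delta ->
  exists N : nat, forall n, (N <= n)%N ->
  forall d (T : measurableType d) (P : probability T R)
    (X : 'I_n -> {RV P >-> R}), iid_normal sigma X ->
  (P [set w | n%:R * t <=
      `|\sum_(i < n) g (X i w) - n%:R * \int[normal_prob 0 sigma]_x g x|]%R
    <= delta%:E)%E.
Proof.
move=> mg ig t0 delta0.
have [N HN] := @weak_law_uniform _ (measurableTypeR R) _ (normal_prob 0 sigma)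
  g t delta mg ig t0 delta0.
exists N => n Nn d T P X [indX Xnu].
have mZ i : @measurable_fun _ _ T (measurableTypeR R) setT (X i).
  exact: (@measurable_funPT _ _ _ _ (X i)).
pose Z i := @mfun_Sub _ _ T (measurableTypeR R) (X i) (mem_set (mZ i)).
apply: (HN n Nn d T P Z) => [i A mA|i j A B ij mA mB]; first exact: Xnu.
transitivity (P (X i @^-1` A) * P (X j @^-1` B))%E.
  exact: mutually_independent_pair.
by congr (_ * _)%E; exact: Xnu.
Qed.

(** * Robustness of typicality under bounded perturbations *)

Theorem theorem3p13 (R : realType) (sigma eta : R) (sigma_gt0 : 0 < sigma)
    (delta eps : R) (delta_gt0 : 0 < delta) (eps_gt0 : 0 < eps) :
  exists N : nat, forall n : nat, (N <= n)%N ->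
  forall (d : measure_display) (T : measurableType d) (P : probability T R)
    (X : 'I_n -> {RV P >-> R}),
    iid_normal sigma X ->
    ((1 - delta)%:E <=
     P [set w | (forall xi : 'rV[R]_n, `|xi| <= eta ->
          typical_set (normal_pdf 0 sigma)
            (log2 (expR 1) * B_infty sigma eta eps n)
            (sample X w + xi))%R])%E.
Proof.
(* For negative [eta] no [xi] is admissible, so the event is the whole space. *)
have [eta_lt0|eta_ge0] := ltrP eta 0.
  exists 0%N => n _ d T P X _.
  rewrite (_ : [set w | _] = setT) ?probability_setT ?lee_fin ?lerBlDr ?lerDl ?ltW//.
  apply/seteqP; split => // w _ xi /= xi_le.
  by have := le_lt_trans xi_le eta_lt0; rewrite ltNge normr_ge0.
pose nu := normal_prob 0 sigma.
pose m1 := (\int[nu]_x `|x|)%R; pose m2 := (\int[nu]_x (x ^+ 2))%R.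
(* The tolerances share the budget [2 * sigma ^+ 2 * eps]: [t2] is one half, and
   [2 * eta * t1 <= t2] because [eta <= eta + 1]. The denominator stays positive at [eta = 0]. *)
pose t1 := eps * sigma ^+ 2 / (2 * (eta + 1)); pose t2 := eps * sigma ^+ 2.
have eta1 : 0 < eta + 1 by rewrite ltr_wpDl.
have t2_gt0 : 0 < t2 by rewrite mulr_gt0// exprn_gt0.
have t1_gt0 : 0 < t1 by rewrite divr_gt0// mulr_gt0.
have delta2 : 0 < delta / 2 by rewrite divr_gt0.
have int2 := integrable_normal_sqr sigma_gt0.
have int1 : nu.-integrable setT (fun x => (`|x| ^+ 2)%:E).
  by apply: eq_integrable int2 => // x _; rewrite real_normK// num_real.
have [N1 HN1] := weak_law_normal (@normr_measurable R setT) int1 t1_gt0 delta2.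
have msqr : measurable_fun setT (fun x : R => x ^+ 2) by exact: measurable_funX.
have int4 : nu.-integrable setT (fun x => ((x ^+ 2) ^+ 2)%:E).
  apply: eq_integrable (normal_fourth_moment_fin sigma_gt0) => // x _.
  by rewrite -exprM.
have [N2 HN2] := weak_law_normal msqr int4 t2_gt0 delta2.
(* The 1 ensures [0 < n], so that dividing by [n] is meaningful. *)
exists (maxn 1 (maxn N1 N2)) => n; rewrite !geq_max => /and3P[n_gt0 N1n N2n].
move=> d T P X iidX.
pose D1 := [set w | n%:R * t1 <= `|\sum_(i < n) `|X i w| - n%:R * m1|].
pose D2 := [set w | n%:R * t2 <= `|\sum_(i < n) X i w ^+ 2 - n%:R * m2|].
have PD1 : (P D1 <= (delta / 2)%:E)%E by exact: HN1 iidX.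
have PD2 : (P D2 <= (delta / 2)%:E)%E by exact: HN2 iidX.
have mX i : measurable_fun setT (X i : T -> R) by [].
have mge (a : R) (g : T -> R) :
    measurable_fun setT g -> measurable [set w | a <= g w].
  move=> mg; rewrite (_ : [set w | _] = g @^-1` `[a, +oo[%classic).
    by rewrite -[_ @^-1` _]setTI; exact: mg.
  by apply/seteqP; split => w /=; rewrite in_itv/= andbT.
have mdev (g : R -> R) (c : R) : measurable_fun setT g ->
    measurable_fun setT (fun w => `|\sum_(i < n) g (X i w) - c|).
  move=> mg; apply: measurableT_comp => //; apply: measurable_funB => //.
  by apply: measurable_sum => i; exact: measurableT_comp.
have mD1 : measurable D1.
  exact: mge (mdev _ (n%:R * m1) (@normr_measurable R setT)).
have mD2 : measurable D2 by exact: mge (mdev _ (n%:R * m2) msqr).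
set A := [set w | _].
pose b := 2 * sigma ^+ 2 * B_infty sigma eta eps n.
pose U w := n%:R^-1 * (\sum_(i < n) (`|X i w| + eta) ^+ 2).
pose L w := n%:R^-1 * (\sum_(i < n) Num.max 0 (`|X i w| - eta) ^+ 2).
have AP w : A w <-> U w - m2 <= b /\ m2 - L w <= b.
  rewrite /U /L -sum_sqr_perturb//.
  by split => H xi /H /(typical_set_normalE sigma_gt0 _ _ n_gt0).
have mA : measurable A.
  (* The bound on [U] is negated so that both sets have the form handled by [mge]. *)
  rewrite (_ : A = [set w | - m2 - b <= - U w] `&` [set w | m2 - b <= L w]).
    have mnX i : measurable_fun setT (fun w => `|X i w|) by exact: measurableT_comp.
    apply: measurableI; apply: mge.
      apply: measurableT_comp => //; apply: measurable_funM => //.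
      apply: measurable_sum => i; apply: measurable_funX.
      exact: measurable_funD.
    apply: measurable_funM => //; apply: measurable_sum => i.
    apply: measurable_funX; apply: measurable_maxr => //.
    exact: measurable_funB.
  by apply/seteqP; split => w /= => [/AP|] [? ?]; [split|apply/AP; split]; lra.
(* Multiplied by [2 * sigma ^+ 2], the term of [B_infty] in [1 / n] becomes the nonnegative slack
   [eps / n%:R]. *)
have bE : eta ^+ 2 + 2 * eta * (m1 + t1) + t2 <= b.
  have -> : b = eta ^+ 2 + 2 * eta * (Num.sqrt (2 / pi) * sigma) +
      2 * t2 + eps / n%:R.
    rewrite /b /B_infty /t2; move: (Num.sqrt _) => a.
    have n_neq0 : n%:R != 0 :> R by rewrite pnatr_eq0 -lt0n.
    by field; rewrite n_neq0 lt0r_neq0.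
  rewrite -normal_abs_moment// -/nu -/m1.
  have : 2 * eta * t1 <= t2.
    rewrite /t1 -/t2 mulrA ler_pdivrMr ?mulr_gt0//.
    nra.
  have : 0 <= eps / n%:R by rewrite divr_ge0// ltW.
  lra.
(* By contraposition: outside [D1] and [D2] both empirical means are within tolerance, which forces
   [A]. *)
have cAD : ~` A `<=` D1 `|` D2.
  move=> w; apply: contra_notP => /not_orP[/negP + /negP].
  rewrite -!ltNge => D1w D2w; apply/AP.
  have [] := sum_sqr_perturb_bounds n_gt0 eta_ge0 D1w D2w.
  by split; exact: le_trans bE.
have PcA : (P (~` A) <= delta%:E)%E.
  apply: (@le_trans _ _ (P (D1 `|` D2))).
    by apply: le_measure; rewrite ?inE//; [exact: measurableC|exact: measurableU].
  apply: (le_trans (measureU2 _ mD1 mD2)).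
  have -> : (delta%:E = (delta / 2)%:E + (delta / 2)%:E)%E.
    by rewrite -EFinD; congr (_%:E); field.
  exact: leeD.
rewrite -[A]setCK probability_setC; last exact: measurableC.
by rewrite EFinB leeB.
Qed.
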